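(* Let $\mathrm{HA}(4)$ be the hive algebra for $\mathrm{GL}(4)$ (defined in the context with $n=4$). (1) $\mathrm{HA}(4)$ is isomorphic, as a $\mathbb{C}$-algebra, to the quotient of the polynomial algebra $\mathbb{C}[x_1,\ldots,x_{20}]$ by the ideal generated by the following fifteen elements: \begin{align*} &r_1: x_1x_7x_9-x_6x_{15}, && r_2: x_1x_8x_9-x_6x_{16},\\ &r_3: x_1x_{11}x_{12}-x_{10}x_{18}, && r_4: x_6x_{11}x_{12}-x_{10}x_{20},\\ &r_5: x_2x_8x_{10}-x_7x_{17}, && r_6: x_2x_8x_{12}-x_7x_{19},\\ &r_7: x_6x_{18}-x_1x_{20}, && r_8: x_7x_{16}-x_8x_{15},\\ &r_9: x_{10}x_{19}-x_{12}x_{17}, && r_{10}: x_{15}x_{17}-x_2x_{10}x_{16},\\ &r_{11}: x_{15}x_{19}-x_2x_{12}x_{16}, && r_{12}: x_{15}x_{20}-x_7x_9x_{18},\\ &r_{13}: x_{16}x_{20}-x_8x_9x_{18}, && r_{14}: x_{17}x_{20}-x_6x_{11}x_{19},\\ &r_{15}: x_{17}x_{18}-x_1x_{11}x_{19}. \end{align*} (2) The Hilbert-Poincaré series of $\mathrm{HA}(4)$ is $\mathfrak{HP}_4(t)=f(t)/g(t)$, where \begin{align*} f(t)&=1-2t-2t^2+10t^3-2t^4-24t^5+22t^6+32t^7-54t^8\\ &\quad-18t^9+80t^{10}-14t^{11}-72t^{12}+34t^{13}+44t^{14}-18t^{15}-25t^{16}\\ &\quad-18t^{17}+44t^{18}+34t^{19}-72t^{20}-14t^{21}+80t^{22}-18t^{23}-54t^{24}\\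 &\quad+32t^{25}+22t^{26}-24t^{27}-2t^{28}+10t^{29}-2t^{30}-2t^{31}+t^{32},\\ g(t)&=(1-t)^4(1-t^2)^6(1-t^{12})^4, \end{align*} which is \[ \mathfrak{HP}_4(t)=1+2t+6t^2+14t^3+34t^4+68t^5+142t^6+268t^7+508t^8+902t^9+\cdots . \]
   Context: Let $n\ge 1$. A sequence $\kappa=(\kappa_1,\ldots,\kappa_n)\in\mathbb{Z}^n$ is non-negative dominant if $\kappa_1\ge\kappa_2\ge\cdots\ge\kappa_n\ge 0$; write $|\kappa|=\kappa_1+\cdots+\kappa_n$. A triangular array is an array of integers $h=(h_{ij})_{1\le j\le i\le n+1}$. Its boundary is the triple $(\underline{a}_h,\underline{b}_h,\underline{c}_h)$ of sequences in $\mathbb{Z}^n$ with $i$-th entries (for $1\le i\le n$) $a_i=h_{i+1,i+1}-h_{i,i}$, $b_i=h_{i+1,1}-h_{i,1}$, $c_i=h_{n+1,i+1}-h_{n+1,i}$. The rhombus conditions are: (i) $h_{i,j}+h_{i+1,j+1}\ge h_{i+1,j}+h_{i,j+1}$ for $1\le j<i\le n$; (ii) $h_{i,j}+h_{i,j+1}\ge h_{i+1,j+1}+h_{i-1,j}$ for $1\le j<i\le n$; (iii) $h_{i+1,j}+h_{i,j}\ge h_{i+1,j+1}+h_{i,j-1}$ for $1<j\le i\le n$. A hive for $\mathrm{GL}(n)$ is a triangular array of integers with $h_{11}=0$, satisfying all the rhombus conditions, and such that the three sequences $\underline{a}_h,\underline{b}_h,\underline{c}_h$ of its boundary are non-negative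 dominant. The set $\mathcal{H}(n)$ of all hives for $\mathrm{GL}(n)$ is a submonoid of $\mathbb{Z}^{(n+1)(n+2)/2}$ under entrywise addition. The hive algebra $\mathrm{HA}(n)$ is the $\mathbb{C}$-subalgebra of the polynomial algebra $\mathbb{C}[z_{ij}:1\le j\le i\le n+1]$ generated by the monomials $\mathbf{z}^h=\prod_{i,j}z_{ij}^{h_{ij}}$ for all $h\in\mathcal{H}(n)$. It is $\mathbb{Z}_{\ge0}$-graded by the degree in $z_{n+1,n+1}$: $\mathbf{z}^h$ has degree $h_{n+1,n+1}$, which equals $|\lambda|=|\mu|+|\nu|$ if $h$ has boundary $(\lambda,\mu,\nu)$. Its Hilbert-Poincaré series is $\mathfrak{HP}_n(t)=\sum_{d\ge0}m_dt^d$, where $m_d$ is the dimension of the degree $d$ homogeneous component of $\mathrm{HA}(n)$. *)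

(* Defs.v *)
From HB Require Import structures.
From mathcomp Require Import all_boot all_order all_algebra.
From mathcomp Require Import generic_quotient ring_quotient.
From mathcomp Require Import boolp reals.
From mathcomp Require Import complex mpoly.

Set Implicit Arguments.
Unset Strict Implicit.
Unset Printing Implicit Defensive.

Import Order.TTheory GRing.Theory Num.Theory.
Local Open Scope ring_scope.

(* A triangular array is a function [h : nat -> nat -> int], read with 1-based
   indices: only the values [h i j] with 1 <= j <= i <= n.+1 are meaningful. *)
Section Hives.
Variable n : nat.

Definition nonneg_dominant (k : nat -> int) : Prop :=
  (forall i, (1 <= i < n)%N -> k i.+1 <= k i) /\ 0 <= k n.

Definition bdry_a (h : nat -> nat -> int) (i : nat) : int :=
  h i.+1 i.+1 - h i i.
Definition bdry_b (h : nat -> nat -> int) (i : nat) : int :=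
  h i.+1 1%N - h i 1%N.
Definition bdry_c (h : nat -> nat -> int) (i : nat) : int :=
  h n.+1 i.+1 - h n.+1 i.

Definition rhombus_i (h : nat -> nat -> int) : Prop :=
  forall i j, (1 <= j < i)%N -> (i <= n)%N ->
    h i j + h i.+1 j.+1 >= h i.+1 j + h i j.+1.
Definition rhombus_ii (h : nat -> nat -> int) : Prop :=
  forall i j, (1 <= j < i)%N -> (i <= n)%N ->
    h i j + h i j.+1 >= h i.+1 j.+1 + h i.-1 j.
Definition rhombus_iii (h : nat -> nat -> int) : Prop :=
  forall i j, (1 < j <= i)%N -> (i <= n)%N ->
    h i.+1 j + h i j >= h i.+1 j.+1 + h i j.-1.

Record hive (h : nat -> nat -> int) : Prop := Hive {
  hive_top : h 1%N 1%N = 0;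
  hive_rhombus_i : rhombus_i h;
  hive_rhombus_ii : rhombus_ii h;
  hive_rhombus_iii : rhombus_iii h;
  hive_bdry_a : nonneg_dominant (bdry_a h);
  hive_bdry_b : nonneg_dominant (bdry_b h);
  hive_bdry_c : nonneg_dominant (bdry_c h)
}.

Lemma nonneg_dominant_ge0 k i :
  nonneg_dominant k -> (1 <= i <= n)%N -> 0 <= k i.
Proof.
case=> kD kn /andP[i1 le_in]; rewrite -(subKn le_in).
have : (n - i < n)%N by rewrite ltn_subrL i1 (leq_trans i1 le_in).
elim: (n - i)%N => [|m IHm] lt_mn; first by rewrite subn0.
apply: le_trans (IHm (ltnW lt_mn)) _.
have -> : (n - m = (n - m.+1).+1)%N by rewrite subnSK // ltnW.
by apply: kD; rewrite subn_gt0 lt_mn /= ltn_subrL /= (leq_ltn_trans _ lt_mn).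
Qed.

Lemma hive_row_le h i j :
  hive h -> (1 <= j < i)%N -> (i <= n.+1)%N -> h i j <= h i j.+1.
Proof.
move=> hh j_i le_in; rewrite -(subKn le_in) in j_i *.
elim: (n.+1 - i)%N j j_i => [|m IHm] j.
  rewrite subn0 ltnS => j_n.
  by have := nonneg_dominant_ge0 (hive_bdry_c hh) j_n; rewrite /bdry_c subr_ge0.
case: (ltnP m n.+1) => [lt_mn | ge_mn]; last first.
  have -> : (n.+1 - m.+1 = 0)%N by apply/eqP; rewrite subn_eq0 ltnW.
  by rewrite ltn0 andbF.
move=> j_i; set r := (n.+1 - m.+1)%N in j_i *.
have Er : (n.+1 - m = r.+1)%N by rewrite /r subnSK.
have := IHm j.+1; rewrite Er ltnS => /(_ ltac:(by case/andP: j_i)) le1.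
have := hive_rhombus_iii hh (i := r) (j := j.+1).
rewrite ltnS j_i => /(_ isT); rewrite /r subSS leq_subr => /(_ isT) /=.
rewrite -/r -subSS -/r => le2.
rewrite -subr_ge0; apply: le_trans (_ : h r.+1 j.+2 - h r.+1 j.+1 <= _).
  by rewrite subr_ge0.
by rewrite lerBlDr addrAC lerBrDr [X in _ <= X]addrC.
Qed.

(* The entries of a hive are natural numbers, so that z^h is a monomial. *)
Lemma hive_ge0 h i j :
  hive h -> (1 <= j <= i)%N -> (i <= n.+1)%N -> 0 <= h i j.
Proof.
move=> hh; elim: j => // j IHj /andP[_ lt_ji] le_in.
case: j => [|j] in IHj lt_ji *; last first.
  apply: le_trans (IHj _ le_in) _; first by rewrite /= ltnW.
  exact: hive_row_le.
case: i lt_ji le_in {IHj} => // i _; rewrite ltnS.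
elim: i => [|i IHi] le_in; first by rewrite (hive_top hh).
apply: le_trans (IHi (ltnW le_in)) _.
by have := nonneg_dominant_ge0 (hive_bdry_b hh) (i := i.+1) le_in;
  rewrite /bdry_b subr_ge0.
Qed.

End Hives.

Section GeneratedStructures.

Definition alg_gen (K : fieldType) (A : comAlgType K) (G : A -> Prop)
    : {pred A} :=
  fun p => `[< forall S : {pred A},
    GRing.subalg_closed S -> (forall x, G x -> x \in S) -> p \in S >].

Lemma alg_gen_subproof (K : fieldType) (A : comAlgType K) (G : A -> Prop) :
  GRing.subsemialg_closed (alg_gen G).
Proof.
apply: GRing.subalg_closed_semi; split.
- by apply/asboolP => S [].
- move=> a u v /asboolP uG /asboolP vG; apply/asboolP => S Sc GS.
  by case: (Sc) => _ SL _; apply: SL; [apply: uG | apply: vG].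
- move=> u v /asboolP uG /asboolP vG; apply/asboolP => S Sc GS.
  by case: (Sc) => _ _ SM; apply: SM; [apply: uG | apply: vG].
Qed.

Definition ideal_gen (A : comNzRingType) (rs : seq A) : {pred A} :=
  fun p => `[< exists c : 'I_(size rs) -> A, p = \sum_i c i * rs`_i >].

End GeneratedStructures.

Section HiveAlgebra.
Variables (K : fieldType) (n : nat).

(* The index set {(i, j) | 1 <= j <= i <= n.+1}. *)
Definition tri : Type := {p : 'I_n.+2 * 'I_n.+2 | (0 < p.2 <= p.1)%N}.
HB.instance Definition _ := Finite.on tri.

(* The position (n.+1, n.+1). *)
Definition corner : tri :=
  @Sub _ (fun p : 'I_n.+2 * 'I_n.+2 => (0 < p.2 <= p.1)%N) tri
    (ord_max, ord_max) (leqnn n.+1).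

Definition zring : Type := {mpoly K[#|{: tri}|]}.
HB.instance Definition _ := GRing.ComAlgebra.on zring.

Definition zvar (p : tri) : zring := 'X_(enum_rank p).

Definition zmonomial (h : nat -> nat -> int) : zring :=
  \prod_(p : tri) zvar p ^+ `|h (val p).1 (val p).2|%N.

Definition hive_pred : {pred zring} :=
  alg_gen (fun p : zring => exists2 h, hive n h & p = zmonomial h).

HB.instance Definition _ := GRing.isSubalgClosed.Build K zring hive_pred
  (alg_gen_subproof _).

Record hive_algebra := HiveAlgebra {
  hive_val :> zring;
  _ : hive_val \in hive_pred
}.
HB.instance Definition _ := [isSub for hive_val].
HB.instance Definition _ := [Choice of hive_algebra by <:].
HB.instance Definition _ := [SubChoice_isSubAlgebra of hive_algebra by <:].

(* The elements whose monomials all have degree d in z_{n+1,n+1}. *)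
Definition hive_component (d : nat) : {pred hive_algebra} :=
  fun p => all (fun m : 'X_{1..#|{: tri}|} => m (enum_rank corner) == d)
               (msupp (hive_val p : {mpoly K[#|{: tri}|]})).

End HiveAlgebra.

Definition has_dim (K : fieldType) (V : lmodType K) (S : {pred V}) (m : nat)
    : Prop :=
  exists b : 'I_m -> V, [/\
    forall i, b i \in S,
    forall c : 'I_m -> K, \sum_i c i *: b i = 0 -> forall i, c i = 0 &
    forall v, v \in S -> exists c : 'I_m -> K, v = \sum_i c i *: b i].

Definition hilbert_poincare (K : fieldType) (n : nat) (m : nat -> nat)
    : Prop :=
  forall d, has_dim (@hive_component K n d) (m d).

(* The formal power series \sum_d s_d t^d is f / g, i.e. g * s = f in Z[[t]];
   this determines s when g(0) != 0. *)
Definition series_quotient (f g : {poly int}) (s : nat -> nat) : Prop :=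
  forall d, \sum_(i < d.+1) g`_i * (s (d - i)%N)%:Z = f`_d.

Section QuotientAlgebra.
Variables (K : fieldType) (A : comAlgType K) (I : idealr A).

Definition quot_alg : Type := {ideal_quot I}.
HB.instance Definition _ := GRing.ComNzRing.on quot_alg.

Definition quot_pi (x : A) : quot_alg :=
  (\pi_{ideal_quot I} x)%qT.

Fact quot_pi_zmod : zmod_morphism quot_pi.
Proof. by move=> x y; rewrite /quot_pi rmorphB. Qed.
Fact quot_pi_monoid : monoid_morphism quot_pi.
Proof.
by split=> [|x y]; rewrite /quot_pi ?rmorph1 ?rmorphM.
Qed.
HB.instance Definition _ := GRing.isZmodMorphism.Build A quot_alg quot_pi
  quot_pi_zmod.
HB.instance Definition _ := GRing.isMonoidMorphism.Build A quot_alg quot_pi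
  quot_pi_monoid.

Definition quot_scale (c : K) (q : quot_alg) : quot_alg := quot_pi c%:A * q.

Fact quot_scaleA a b v :
  quot_scale a (quot_scale b v) = quot_scale (a * b) v.
Proof. by rewrite /quot_scale mulrA -rmorphM -!in_algE -rmorphM. Qed.
Fact quot_scale1 : left_id 1 quot_scale.
Proof. by move=> v; rewrite /quot_scale scale1r rmorph1 mul1r. Qed.
Fact quot_scaleDr : right_distributive quot_scale +%R.
Proof. by move=> a u v; rewrite /quot_scale mulrDr. Qed.
Fact quot_scaleDl v : {morph quot_scale^~ v : a b / a + b}.
Proof. by move=> a b; rewrite /quot_scale scalerDl rmorphD mulrDl. Qed.
HB.instance Definition _ := GRing.Zmodule_isLmodule.Build K quot_alg
  quot_scaleA quot_scale1 quot_scaleDr quot_scaleDl.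

Fact quot_scaleAl (a : K) (u v : quot_alg) : a *: (u * v) = a *: u * v.
Proof. exact: mulrA. Qed.
HB.instance Definition _ := GRing.Lmodule_isLalgebra.Build K quot_alg
  quot_scaleAl.
HB.instance Definition _ := GRing.Lalgebra_isComAlgebra.Build K quot_alg.

Fact quot_pi_scalable : scalable quot_pi.
Proof. by move=> a x; rewrite -mulr_algl rmorphM. Qed.
HB.instance Definition _ := GRing.isScalable.Build K A quot_alg *:%R quot_pi
  quot_pi_scalable.

End QuotientAlgebra.

Section Relations.
Variable K : fieldType.

(* x k, for 1 <= k <= 20, is the k-th variable of the polynomial ring. *)
Let x (k : nat) : {mpoly K[20]} := 'X_(inord k.-1).

Definition hive4_relations : seq {mpoly K[20]} := [::
  x 1 * x 7 * x 9 - x 6 * x 15;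
  x 1 * x 8 * x 9 - x 6 * x 16;
  x 1 * x 11 * x 12 - x 10 * x 18;
  x 6 * x 11 * x 12 - x 10 * x 20;
  x 2 * x 8 * x 10 - x 7 * x 17;
  x 2 * x 8 * x 12 - x 7 * x 19;
  x 6 * x 18 - x 1 * x 20;
  x 7 * x 16 - x 8 * x 15;
  x 10 * x 19 - x 12 * x 17;
  x 15 * x 17 - x 2 * x 10 * x 16;
  x 15 * x 19 - x 2 * x 12 * x 16;
  x 15 * x 20 - x 7 * x 9 * x 18;
  x 16 * x 20 - x 8 * x 9 * x 18;
  x 17 * x 20 - x 6 * x 11 * x 19;
  x 17 * x 18 - x 1 * x 11 * x 19].

Definition hive4_ideal : {pred {mpoly K[20]}} := ideal_gen hive4_relations.

Fact hive4_ideal_closed : idealr_closed hive4_ideal.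
Proof.
split.
- by apply/asboolP; exists (fun=> 0); rewrite big1 // => i _; rewrite mul0r.
- apply/negP => /asboolP[c /(congr1 (meval (fun=> 0)))].
  rewrite rmorph1 rmorph_sum big1 => [/eqP|i _]; first by rewrite oner_eq0.
  rewrite rmorphM /=.
  suff /allP r0 : all (fun r => r.@[fun=> 0] == 0) hive4_relations.
    by rewrite (eqP (r0 _ (mem_nth _ (ltn_ord i)))) mulr0.
  by rewrite /= /x !(mevalB, mevalM, mevalXU, mulr0, subr0, eqxx).
- move=> a u v /asboolP[c ->] /asboolP[e ->]; apply/asboolP.
  exists (fun i => a * c i + e i).
  rewrite mulr_sumr -big_split; apply: eq_bigr => i _ /=.
  by rewrite mulrA mulrDl.
Qed.
HB.instance Definition _ := isIdealr.Build {mpoly K[20]} hive4_ideal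
  hive4_ideal_closed.

(* K[x_1, ..., x_20] / (r_1, ..., r_15). *)
Definition hive4_quotient : comAlgType K := quot_alg (hive4_ideal : idealr _).

End Relations.

Arguments hive4_ideal K : clear implicits.

Definition hive4_num : {poly int} := Poly [::
  1; -2; -2; 10; -2; -24; 22; 32; -54;
  -18; 80; -14; -72; 34; 44; -18; -25;
  -18; 44; 34; -72; -14; 80; -18; -54;
  32; 22; -24; -2; 10; -2; -2; 1].

Definition hive4_den : {poly int} :=
  (1 - 'X) ^+ 4 * (1 - 'X^2) ^+ 6 * (1 - 'X^12) ^+ 4.

(* Main.v *)
From HB Require Import structures.
Require Import Defs.
From mathcomp Require Import all_boot all_order all_algebra.
From mathcomp Require Import reals complex.
From mathcomp Require Import boolp generic_quotient ring_quotient mpoly.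
From mathcomp Require Import ring zify.

(** The hive cone of GL(4) has twenty generating hives, tabulated below so that
the k-th one is the exponent of the image of x_k under the presentation map
psi : K[x_1, ..., x_20] -> K[z].

Each of the fifteen relations is, up to sign, the difference of a quadratic
monomial x_k x_l, called its lead here, and another monomial with the same
image under psi.  A monomial divisible by no lead is called standard.  Three
facts about standard monomials carry the proof.

- Every monomial is congruent to a standard one modulo the relations
  ([standard_reduce]): replacing a lead by the other monomial of its relation
  lowers a suitable weight.
- Every hive is the exponent of the image of a standard monomial
  ([hive_standard]).
- A standard monomial is determined by its image ([standard_inj]).

The first and the third show that the kernel of psi is the ideal of the
relations: a polynomial in the kernel reduces to a combination of standard
monomials, whose images are distinct, so that it reduces to 0.  The second one
shows that the image of psi is the hive algebra, and part (1) is the first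
isomorphism theorem.

The last two facts come from an explicit change of coordinates.  The variables
x_3, x_4, x_5, x_13, x_14 occur in no relation.  In the remaining nine lattice
coordinates A, B, C, p1, p2, q1, q2, r1, r2 -- those of x_9, x_11, x_2, x_1,
x_6, x_8, x_7, x_12, x_10 -- the other generators are
x_15 = A q2 p1/p2, x_16 = A q1 p1/p2, x_18 = B p1 r1/r2, x_20 = B p2 r1/r2,
x_17 = C r2 q1/q2, x_19 = C r1 q1/q2 (written multiplicatively), which is
invariant under the cyclic shift p -> q -> r -> p, A -> C -> B -> A.  In a
standard monomial the multiplicity x_15 + x_16 is the negative part of the
p2-coordinate, and likewise for the two shifts; once these three numbers are
known, each third of the coordinates is solved for separately
([block_exists], [block_uniq]).

By the same facts the images of the standard monomials of degree d form a basis
of the degree d component of the hive algebra.  The leads are square-free and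
quadratic, so that standard monomials are those whose support is an independent
set of a graph on the twenty variables.  Splitting off the variables one by one
gives both an enumeration of these monomials and, in parallel, the numerator of
their generating series over the product of the 1 - t^(deg x_k) ([den_count]);
comparing with the stated fraction is then an identity between polynomials with
explicit coefficients ([hive4_cross]). *)

Set Implicit Arguments.
Unset Strict Implicit.
Unset Printing Implicit Defensive.

Import Order.TTheory GRing.Theory Num.Theory.
Local Open Scope ring_scope.

(** * Generating hives and leads *)

(** The generating hives, each one listed row by row: the entry (i, j) has
position 'C(i, 2) + j - 1. *)
Definition gen_table : seq (seq nat) := [::
  [:: 0; 1; 1; 2; 2; 2; 3; 3; 3; 3; 3; 3; 3; 3; 3];
  [:: 0; 1; 1; 2; 2; 2; 2; 2; 2; 2; 2; 2; 2; 2; 2];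
  [:: 0; 1; 1; 1; 1; 1; 1; 1; 1; 1; 1; 1; 1; 1; 1];
  [:: 0; 0; 1; 0; 1; 2; 0; 1; 2; 3; 0; 1; 2; 3; 3];
  [:: 0; 0; 1; 0; 1; 2; 0; 1; 2; 3; 0; 1; 2; 3; 4];
  [:: 0; 1; 2; 2; 3; 4; 3; 4; 5; 5; 3; 4; 5; 6; 6];
  [:: 0; 1; 2; 2; 3; 3; 2; 3; 4; 4; 2; 3; 4; 5; 5];
  [:: 0; 1; 1; 1; 2; 2; 1; 2; 3; 3; 1; 2; 3; 4; 4];
  [:: 0; 0; 1; 0; 1; 2; 0; 1; 2; 2; 0; 1; 2; 2; 2];
  [:: 0; 1; 2; 2; 3; 3; 3; 4; 4; 4; 3; 4; 5; 5; 5];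
  [:: 0; 1; 1; 2; 2; 2; 2; 3; 3; 3; 2; 3; 4; 4; 4];
  [:: 0; 0; 1; 0; 1; 1; 0; 1; 1; 1; 0; 1; 1; 1; 1];
  [:: 0; 1; 1; 2; 2; 2; 3; 3; 3; 3; 3; 4; 4; 4; 4];
  [:: 0; 1; 1; 2; 2; 2; 3; 3; 3; 3; 4; 4; 4; 4; 4];
  [:: 0; 1; 2; 2; 3; 3; 2; 3; 4; 4; 2; 3; 4; 4; 4];
  [:: 0; 1; 1; 1; 2; 2; 1; 2; 3; 3; 1; 2; 3; 3; 3];
  [:: 0; 2; 2; 3; 4; 4; 4; 5; 5; 5; 4; 5; 6; 6; 6];
  [:: 0; 1; 1; 2; 2; 2; 2; 3; 3; 3; 2; 3; 3; 3; 3];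
  [:: 0; 1; 1; 1; 2; 2; 1; 2; 2; 2; 1; 2; 2; 2; 2];
  [:: 0; 1; 2; 2; 3; 4; 2; 4; 5; 5; 2; 4; 5; 6; 6]]%N.

(** The entry (i, j) of the k-th generating hive; like the variables, the
generators are numbered from 1 to 20. *)
Definition gen (k i j : nat) : nat :=
  nth 0%N (nth [::] gen_table k.-1) ('C(i, 2) + j.-1)%N.

(** The hive in which the k-th generator has multiplicity [c k]. *)
Definition comb (c : nat -> nat) (i j : nat) : nat :=
  (\sum_(k <- iota 1 20) c k * gen k i j)%N.

(** The relations, in their original order, as pairs consisting of the lead and
of the other monomial; monomials are lists of indices of variables. *)
Definition rules : seq (seq nat * seq nat) := [::
  ([:: 6; 15], [:: 1; 7; 9]);  ([:: 6; 16], [:: 1; 8; 9]);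
  ([:: 10; 18], [:: 1; 11; 12]); ([:: 10; 20], [:: 6; 11; 12]);
  ([:: 7; 17], [:: 2; 8; 10]); ([:: 7; 19], [:: 2; 8; 12]);
  ([:: 6; 18], [:: 1; 20]); ([:: 7; 16], [:: 8; 15]);
  ([:: 10; 19], [:: 12; 17]); ([:: 15; 17], [:: 2; 10; 16]);
  ([:: 15; 19], [:: 2; 12; 16]); ([:: 15; 20], [:: 7; 9; 18]);
  ([:: 16; 20], [:: 8; 9; 18]); ([:: 17; 20], [:: 6; 11; 19]);
  ([:: 17; 18], [:: 1; 11; 19])]%N.

(** [c] is the exponent of a monomial divisible by no lead. *)
Definition standard (c : nat -> nat) : bool :=
  all (fun r : seq nat * seq nat => has (fun k => c k == 0%N) r.1) rules.

Lemma triP (P : nat -> nat -> Prop) :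
  (forall i j, (1 <= j <= i)%N -> (i <= 5)%N -> P i j) <->
  [/\ P 1 1, P 2 1 & P 2 2]%N /\ [/\ P 3 1, P 3 2 & P 3 3]%N /\
  [/\ P 4 1, P 4 2, P 4 3 & P 4 4]%N /\
  [/\ P 5 1, P 5 2, P 5 3, P 5 4 & P 5 5]%N.
Proof.
split=> [H|]; first by do !split; apply: H.
move=> [[? ? ?] [[? ? ?] [[? ? ? ?] [? ? ? ? ?]]]].
by move=> [|[|[|[|[|[|i]]]]]] [|[|[|[|[|[|j]]]]]].
Qed.

Lemma combE c i j : comb c i j =
  foldr (fun k m => c k * gen k i j + m)%N 0%N (iota 1 20).
Proof. by rewrite /comb unlock. Qed.

Lemma comb_hive c : hive 4 (fun i j => (comb c i j)%:Z).
Proof.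
have P i j := combE c i j.
split; rewrite /rhombus_i /rhombus_ii /rhombus_iii /nonneg_dominant
  /bdry_a /bdry_b /bdry_c.
- by rewrite P /= /gen /=; lia.
- move=> [|[|[|[|[|i]]]]] // [|[|[|[|[|j]]]]] // _ _;
    by rewrite !P /gen /=; lia.
- move=> [|[|[|[|[|i]]]]] // [|[|[|[|[|j]]]]] // _ _;
    by rewrite !P /gen /=; lia.
- move=> [|[|[|[|[|i]]]]] // [|[|[|[|[|j]]]]] // _ _;
    by rewrite !P /gen /=; lia.
- split; last by rewrite !P /gen /=; lia.
  by move=> [|[|[|[|i]]]] // _; rewrite !P /gen /=; lia.
- split; last by rewrite !P /gen /=; lia.
  by move=> [|[|[|[|i]]]] // _; rewrite !P /gen /=; lia.
- split; last by rewrite !P /gen /=; lia.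
  by move=> [|[|[|[|i]]]] // _; rewrite !P /gen /=; lia.
Qed.

(** * Standard decompositions of hives *)

(** [block_exists] and [block_uniq] deal with one third of the coordinates,
written for p: [x], [y], [u], [v] are the multiplicities of x_1, x_6, x_18,
x_20, [a] is that of x_15 and x_16 together, and [b] is the negative part of
the coordinate r2. *)
Lemma block_exists (p1 p2 : int) (b : nat) :
    0 <= p1 -> 0 <= p1 + p2 -> b%:Z <= p1 + p2 ->
  exists x y u v a : nat,
    [/\ (u + v)%N = b, p1 = x%:Z + a%:Z + u%:Z, p2 = y%:Z - a%:Z + v%:Z &
      [/\ a = absz (Num.max 0 (- p2)), a = 0%N \/ y = 0%N, a = 0%N \/ v = 0%N &
        y = 0%N \/ u = 0%N]].
Proof.
move=> p1_ge0 p12_ge0 le_b.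
have [p2_ge0 | p2_lt0] := lerP 0 p2.
  have [le_bp2 | lt_p2b] := lerP b%:Z p2.
    exists (absz p1), (absz (p2 - b%:Z)%R), 0%N, b, 0%N.
    by split; try lia; split; lia.
  exists (absz (p1 - (b%:Z - p2))%R), 0%N, (absz (b%:Z - p2)%R), (absz p2), 0%N.
  by split; try lia; split; lia.
exists (absz (p1 + p2 - b%:Z)%R), 0%N, b, 0%N, (absz p2).
by split; try lia; split; lia.
Qed.

Lemma block_neg_uniq (y v a y' v' a' : nat) :
    (a = 0 \/ y = 0)%N -> (a = 0 \/ v = 0)%N ->
    (a' = 0 \/ y' = 0)%N -> (a' = 0 \/ v' = 0)%N ->
    y%:Z - a%:Z + v%:Z = y'%:Z - a'%:Z + v'%:Z ->
  a = a' /\ (y + v = y' + v')%N.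
Proof. lia. Qed.

Lemma block_uniq (x y u v a x' y' u' v' : nat) :
    (y = 0 \/ u = 0)%N -> (y' = 0 \/ u' = 0)%N ->
    (u + v = u' + v')%N -> (y + v = y' + v')%N ->
    x%:Z + a%:Z + u%:Z = x'%:Z + a%:Z + u'%:Z ->
  [/\ x = x', y = y', u = u' & v = v'].
Proof. by move=> *; split; lia. Qed.

(** The exponent with the entries of [s], numbered from 1. *)
Definition seqfun (s : seq nat) (k : nat) : nat := nth 0%N s k.-1.

(** [h i j], for numerals [i] and [j] read as natural numbers. *)
Definition entry (h : nat -> nat -> int) (i j : nat) : int := h i j.

(** The coordinates of a triangular array with [h 1 1 = 0] in the lattice basis
formed by the generators 9, 11, 2, 1, 6, 8, 7, 12, 10 and 3, 4, 5, 13, 14. *)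
Definition coordA h := - entry h 4 2 + entry h 4 3 + entry h 5 3 - entry h 5 4.
Definition coordB h := entry h 3 1 - entry h 3 2 - entry h 4 1 + entry h 4 2.
Definition coordC h := - entry h 2 2 + entry h 3 2 + entry h 3 3 - entry h 4 3.
Definition coordp1 h := - entry h 3 3 + entry h 4 3 + entry h 4 4 - entry h 5 4.
Definition coordp2 h := - entry h 3 2 + entry h 3 3 + entry h 4 2 - entry h 4 4
  - entry h 5 3 + entry h 5 4.
Definition coordq1 h := entry h 2 1 - entry h 2 2 - entry h 3 1 + entry h 3 2.
Definition coordq2 h := - entry h 2 1 + entry h 2 2 + entry h 3 1 - entry h 3 3
  - entry h 4 2 + entry h 4 3.
Definition coordr1 h := - entry h 4 1 + entry h 4 2 + entry h 5 2 - entry h 5 3.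
Definition coordr2 h := - entry h 3 1 + entry h 3 2 + entry h 4 1 - entry h 4 3
  - entry h 5 2 + entry h 5 3.
Definition coord3 h := entry h 2 1 + entry h 2 2 - entry h 3 2.
Definition coord4 h := - entry h 4 3 + entry h 4 4 + entry h 5 4 - entry h 5 5.
Definition coord5 h := entry h 5 5 - entry h 5 4.
Definition coord13 h := entry h 4 1 - entry h 4 2 - entry h 5 1 + entry h 5 2.
Definition coord14 h := entry h 5 1 - entry h 4 1.

(** Inequalities between the coordinates of a hive; those of each third are the
hypotheses of [block_exists] and leave room for the generators 9, 11, 2. *)
Lemma hive_cone h : hive 4 h ->
 [/\ [/\ 0 <= coordA h, 0 <= coordA h + coordp2 h, 0 <= coordp1 h,
         0 <= coordp1 h + coordp2 h & 0 <= coordp1 h + coordp2 h + coordr2 h],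
     [/\ 0 <= coordC h, 0 <= coordC h + coordq2 h, 0 <= coordq1 h,
         0 <= coordq1 h + coordq2 h & 0 <= coordq1 h + coordq2 h + coordp2 h],
     [/\ 0 <= coordB h, 0 <= coordB h + coordr2 h, 0 <= coordr1 h,
         0 <= coordr1 h + coordr2 h & 0 <= coordr1 h + coordr2 h + coordq2 h] &
     [/\ 0 <= coord3 h, 0 <= coord4 h, 0 <= coord5 h, 0 <= coord13 h &
         0 <= coord14 h]].
Proof.
case=> h11 hi hii hiii [_ a4] [_ b4] [_ c4].
have {}hi i j (j_i : (1 <= j < i)%N && (i <= 4)%N) :
    h i j + h i.+1 j.+1 >= h i.+1 j + h i j.+1.
  by case/andP: j_i; apply: hi.
have {}hii i j (j_i : (1 <= j < i)%N && (i <= 4)%N) :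
    h i j + h i j.+1 >= h i.+1 j.+1 + h i.-1 j.
  by case/andP: j_i; apply: hii.
have {}hiii i j (j_i : (1 < j <= i)%N && (i <= 4)%N) :
    h i.+1 j + h i j >= h i.+1 j.+1 + h i j.-1.
  by case/andP: j_i; apply: hiii.
have := (hi 2 1 isT, hi 3 1 isT, hi 3 2 isT,
  hi 4 1 isT, hi 4 2 isT, hi 4 3 isT)%N.
have := (hii 2 1 isT, hii 3 1 isT, hii 3 2 isT,
  hii 4 1 isT, hii 4 2 isT, hii 4 3 isT)%N.
have := (hiii 2 2 isT, hiii 3 2 isT, hiii 3 3 isT,
  hiii 4 2 isT, hiii 4 3 isT, hiii 4 4 isT)%N.
move: h11 a4 b4 c4; rewrite /bdry_a /bdry_b /bdry_c /=.
move=> h11 a4 b4 c4 {hi hii hiii}.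
move=> [[[[[i1 i2] i3] i4] i5] i6] [[[[[j1 j2] j3] j4] j5] j6].
move=> [[[[[k1 k2] k3] k4] k5] k6].
rewrite /coordA /coordB /coordC /coordp1 /coordp2 /coordq1 /coordq2.
rewrite /coordr1 /coordr2.
rewrite /coord3 /coord4 /coord5 /coord13 /coord14 /entry.
by do !split; lia.
Qed.

(** Every hive is a combination of the generating hives with the exponent of a
standard monomial as multiplicities. *)
Lemma hive_standard h : hive 4 h ->
  exists s : seq nat, [/\ size s = 20, standard (seqfun s) &
    forall i j, (1 <= j <= i)%N -> (i <= 5)%N ->
      h i j = (comb (seqfun s) i j)%:Z].
Proof.
move=> hh; have [[pA pAp p0 p00 pp] [qC qCq q0 q00 qq] [rB rBr r0 r00 rr]] :=
  hive_cone hh.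
have [x1 [x6 [x18 [x20 [a [b18 e1 e6 [ea pa1 pa2 pa3]]]]]]] :=
  @block_exists _ (coordp2 h) (absz (Num.max 0 (- coordr2 h)))
    p0 p00 ltac:(lia).
have [x8 [x7 [x16 [x15 [c [a16 e8 e7 [ec pc1 pc2 pc3]]]]]]] :=
  @block_exists _ (coordq2 h) (absz (Num.max 0 (- coordp2 h)))
    q0 q00 ltac:(lia).
have [x12 [x10 [x19 [x17 [b [c19 e12 e10 [eb pb1 pb2 pb3]]]]]]] :=
  @block_exists _ (coordr2 h) (absz (Num.max 0 (- coordq2 h)))
    r0 r00 ltac:(lia).
move=> [g3 g4 g5 g13 g14].
have a_eq : a = (x16 + x15)%N by rewrite a16 ea.
have b_eq : b = (x18 + x20)%N by rewrite b18 eb.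
have c_eq : c = (x19 + x17)%N by rewrite c19 ec.
(* What is left of A, B, C belongs to the generators 9, 11, 2. *)
pose x9 := absz (coordA h - a%:Z)%R.
pose x11 := absz (coordB h - b%:Z)%R.
pose x2 := absz (coordC h - c%:Z)%R.
have e9 : coordA h = x9%:Z + x15%:Z + x16%:Z by clear -pA pAp ea a_eq; lia.
have e11 : coordB h = x11%:Z + x18%:Z + x20%:Z by clear -rB rBr eb b_eq; lia.
have e2 : coordC h = x2%:Z + x17%:Z + x19%:Z by clear -qC qCq ec c_eq; lia.
exists [:: x1; x2; absz (coord3 h); absz (coord4 h); absz (coord5 h); x6; x7;
  x8; x9; x10; x11; x12; absz (coord13 h); absz (coord14 h); x15; x16; x17;
  x18; x19; x20].
split=> //.
  rewrite /standard /= /seqfun /=.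
  by repeat (apply/andP; split); rewrite ?orbF //; apply/orP;
    first [clear -pa1 a_eq; lia | clear -pa2 a_eq; lia | clear -pa3; lia
         | clear -pb1 b_eq; lia | clear -pb2 b_eq; lia | clear -pb3; lia
         | clear -pc1 c_eq; lia | clear -pc2 c_eq; lia | clear -pc3; lia].
have h11 := hive_top hh.
clear -h11 e1 e6 e8 e7 e12 e10 e9 e11 e2 g3 g4 g5 g13 g14 a_eq b_eq c_eq.
apply/triP.
move: e1 e6 e8 e7 e12 e10 e9 e11 e2 (gez0_abs g3) (gez0_abs g4) (gez0_abs g5)
 (gez0_abs g13) (gez0_abs g14).
move: (absz _) (absz _) (absz _) (absz _) (absz _) => x3 x4 x5 x13 x14.
rewrite /coordA /coordB /coordC /coordp1 /coordp2 /coordq1 /coordq2.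
rewrite /coordr1 /coordr2.
rewrite /coord3 /coord4 /coord5 /coord13 /coord14 /entry.
move=> e1 e6 e8 e7 e12 e10 e9 e11 e2 e3 e4 e5 e13 e14.
by do !split; rewrite combE /gen /seqfun /=; lia.
Qed.

Lemma coord_comb c : let h i j := (comb c i j)%:Z in
 [/\ [/\ coordA h = (c 9 + c 15 + c 16)%N%:Z,
         coordB h = (c 11 + c 18 + c 20)%N%:Z &
         coordC h = (c 2 + c 17 + c 19)%N%:Z],
     [/\ coordp1 h = (c 1)%N%:Z + (c 15 + c 16)%N%:Z + (c 18)%N%:Z &
         coordp2 h = (c 6)%N%:Z - (c 15 + c 16)%N%:Z + (c 20)%N%:Z],
     [/\ coordq1 h = (c 8)%N%:Z + (c 17 + c 19)%N%:Z + (c 16)%N%:Z &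
         coordq2 h = (c 7)%N%:Z - (c 17 + c 19)%N%:Z + (c 15)%N%:Z],
     [/\ coordr1 h = (c 12)%N%:Z + (c 18 + c 20)%N%:Z + (c 19)%N%:Z &
         coordr2 h = (c 10)%N%:Z - (c 18 + c 20)%N%:Z + (c 17)%N%:Z] &
     [/\ coord3 h = (c 3)%N%:Z, coord4 h = (c 4)%N%:Z, coord5 h = (c 5)%N%:Z,
         coord13 h = (c 13)%N%:Z & coord14 h = (c 14)%N%:Z]].
Proof.
have P i j := combE c i j.
move=> h; rewrite /coordA /coordB /coordC /coordp1 /coordp2 /coordq1 /coordq2.
rewrite /coordr1 /coordr2.
rewrite /coord3 /coord4 /coord5 /coord13 /coord14 /entry /h.
by rewrite !P /gen /=; split; split; lia.
Qed.

(** The fifteen conditions in [standard], grouped by thirds. *)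
Lemma standardP c : standard c ->
 [/\ [/\ c 15 + c 16 = 0 \/ c 6 = 0, c 15 + c 16 = 0 \/ c 20 = 0 &
         c 6 = 0 \/ c 18 = 0],
     [/\ c 17 + c 19 = 0 \/ c 7 = 0, c 17 + c 19 = 0 \/ c 15 = 0 &
         c 7 = 0 \/ c 16 = 0] &
     [/\ c 18 + c 20 = 0 \/ c 10 = 0, c 18 + c 20 = 0 \/ c 17 = 0 &
         c 10 = 0 \/ c 19 = 0]]%N.
Proof.
rewrite /standard /= !orbF !andbT.
case/and5P=> h6_15 h6_16 h10_18 h10_20 /and5P[h7_17 h7_19 h6_18 h7_16].
case/and5P=> h10_19 h15_17 h15_19 h15_20 /and3P[h16_20 h17_20 h17_18].
split; split.
- by clear -h6_15 h6_16; lia.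
- by clear -h15_20 h16_20; lia.
- by clear -h6_18; lia.
- by clear -h7_17 h7_19; lia.
- by clear -h15_17 h15_19; lia.
- by clear -h7_16; lia.
- by clear -h10_18 h10_20; lia.
- by clear -h17_18 h17_20; lia.
- by clear -h10_19; lia.
Qed.

(** A standard monomial is determined by the hive that it represents. *)
Lemma standard_inj c c' : standard c -> standard c' ->
    (forall i j, (1 <= j <= i)%N -> (i <= 5)%N -> comb c i j = comb c' i j) ->
  forall k, (1 <= k <= 20)%N -> c k = c' k.
Proof.
move=> /standardP[[pa1 pa2 pa3] [pc1 pc2 pc3] [pb1 pb2 pb3]].
move=> /standardP[[pa1' pa2' pa3'] [pc1' pc2' pc3'] [pb1' pb2' pb3']].
move=> /triP[[_ g21 g22] [[g31 g32 g33] [[g41 g42 g43 g44]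
  [g51 g52 g53 g54 g55]]]].
have := coord_comb c'; have /= := coord_comb c.
rewrite /coordA /coordB /coordC /coordp1 /coordp2 /coordq1 /coordq2.
rewrite /coordr1 /coordr2.
rewrite /coord3 /coord4 /coord5 /coord13 /coord14 /entry.
rewrite g21 g22 g31 g32 g33 g41 g42 g43 g44 g51 g52 g53 g54 g55.
case=> [[-> -> ->] [-> ->] [-> ->] [-> ->] [-> -> -> -> ->]].
case=> [[eA eB eC] [ep1 ep2] [eq1 eq2] [er1 er2] [[e3] [e4] [e5] [e13] [e14]]].
have [ea sp] := block_neg_uniq pa1 pa2 pa1' pa2' ep2.
have [ec sq] := block_neg_uniq pc1 pc2 pc1' pc2' eq2.
have [eb sr] := block_neg_uniq pb1 pb2 pb1' pb2' er2.
rewrite -ea in ep1; rewrite -ec in eq1; rewrite -eb in er1.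
have [e1 e6 e18 e20] := block_uniq pa3 pa3' eb sp ep1.
rewrite addnC [RHS]addnC in ea; rewrite addnC [RHS]addnC in ec.
have [e8 e7 e16 e15] := block_uniq pc3 pc3' ea sq eq1.
have [e12 e10 e19 e17] := block_uniq pb3 pb3' ec sr er1.
clear -e1 e3 e4 e5 e6 e7 e8 e10 e12 e13 e14 e15 e16 e17 e18 e19 e20 eA eB eC.
have e9 : c 9%N = c' 9%N by clear -e15 e16 eA; lia.
have e11 : c 11%N = c' 11%N by clear -e18 e20 eB; lia.
have e2 : c 2%N = c' 2%N by clear -e17 e19 eC; lia.
by do 21?[case=> //].
Qed.

(** * Monomials *)

Notation N := #|{: tri 4}|.

(** The exponent of x_k in the monomial [u]; meaningful for 1 <= k <= 20. *)
Definition expo (u : 'X_{1..20}) (k : nat) : nat := u (inord k.-1).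

(** The monomial in which x_k has exponent [c k], for 1 <= k <= 20. *)
Definition mon (c : nat -> nat) : 'X_{1..20} := [multinom c i.+1 | i < 20].

Lemma expo_mon c k : (0 < k <= 20)%N -> expo (mon c) k = c k.
Proof. by case: k => // k /= lt_k20; rewrite /expo mnmE inordK. Qed.

Lemma mon_expo u : mon (expo u) = u.
Proof. by apply/mnmP => i; rewrite mnmE /expo inord_val. Qed.

(** The additive function of [u] with value [g k] at x_k. *)
Definition lin (g : nat -> nat) (u : 'X_{1..20}) : nat :=
  (\sum_(k <- iota 1 20) expo u k * g k)%N.

Lemma linE g u : lin g u = (\sum_(i < 20) u i * g i.+1)%N.
Proof.
rewrite /lin -[iota 1 20]/(index_iota 1 21) big_add1 big_mkord.
by apply: eq_bigr => i _; rewrite /expo /= inord_val.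
Qed.

Lemma linD g u v : lin g (u + v) = (lin g u + lin g v)%N.
Proof.
by rewrite -big_split; apply: eq_bigr => k _; rewrite /expo mnmDE mulnDl.
Qed.

Lemma lin0 g : lin g 0 = 0%N.
Proof. by rewrite linE big1 // => i _; rewrite mnm0E. Qed.

Lemma lin1 g i : lin g U_(i) = g i.+1.
Proof.
rewrite linE (bigD1 i) //= mnm1E eqxx mul1n big1 ?addn0 // => j ne_ji.
by rewrite mnm1E eq_sym (negbTE ne_ji).
Qed.

(** The exponent of the product of the variables whose indices are in [xs]. *)
Definition mexp (xs : seq nat) : 'X_{1..20} :=
  (\big[+%MM/0%MM]_(k <- xs) U_(inord k.-1))%MM.

Lemma lin_mexp g xs : all (fun k => 0 < k <= 20)%N xs ->
  lin g (mexp xs) = (\sum_(k <- xs) g k)%N.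
Proof.
move=> /allP xs20; rewrite /mexp (big_morph _ (linD g) (lin0 g)).
apply: eq_big_seq => k /xs20; rewrite lin1; case: k => //= k k20.
by rewrite inordK.
Qed.

Lemma mexp_le xs u : uniq xs -> all (fun k => 0 < k <= 20)%N xs ->
  all (fun k => expo u k != 0)%N xs -> (mexp xs <= u)%MM.
Proof.
move=> xs_uniq /allP xs20 /allP xs_u; apply/mnm_lepP => i; rewrite mnm_sumE.
have [i_xs | i_xs] := boolP (i.+1 \in xs); last first.
  rewrite big1_seq // => k /andP[_ k_xs]; rewrite mnm1E; apply/eqP.
  rewrite eqb0; apply: contra i_xs => /eqP <-.
  by have := xs20 k k_xs; case: (k) k_xs => // k' + k'20; rewrite /= inordK.
rewrite (bigD1_seq i.+1) //= mnm1E inord_val eqxx big1_seq ?addn0.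
  by have := xs_u _ i_xs; rewrite /expo /= inord_val lt0n.
move=> k /andP[ne_ki k_xs]; rewrite mnm1E; apply/eqP; rewrite eqb0.
apply: contra ne_ki => /eqP <-.
by have := xs20 k k_xs; case: (k) => // k' k'20; rewrite /= inordK.
Qed.

(** The exponent of the monomial in the z_ij to which psi sends [u]. *)
Definition zexp (u : 'X_{1..20}) : 'X_{1..N} :=
  [multinom comb (expo u) (val (enum_val i)).1 (val (enum_val i)).2 | i < N].

Lemma zexpD u v : zexp (u + v) = (zexp u + zexp v)%MM.
Proof. by apply/mnmP => i; rewrite mnmDE !mnmE; apply: linD. Qed.

Lemma zexp0 : zexp 0 = 0%MM.
Proof. by apply/mnmP => i; rewrite mnm0E mnmE; apply: lin0. Qed.

Lemma zexpP u v :
  zexp u = zexp v <-> (forall i j, (1 <= j <= i)%N -> (i <= 5)%N ->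
    comb (expo u) i j = comb (expo v) i j).
Proof.
split=> [/mnmP eq_uv i j j_i i5 | eq_uv].
  have [j0 le_ji] := andP j_i.
  have j5 := leq_trans le_ji i5.
  pose p : tri 4 := @Sub _ (fun p : 'I_6 * 'I_6 => (0 < p.2 <= p.1)%N) (tri 4)
    (Ordinal (i5 : i < 6)%N, Ordinal (j5 : j < 6)%N) j_i.
  by have := eq_uv (enum_rank p); rewrite !mnmE enum_rankK SubK.
apply/mnmP => i; rewrite !mnmE; apply: eq_uv; first exact: valP (enum_val i).
by rewrite -ltnS ltn_ord.
Qed.

Lemma comb_lin u i j : comb (expo u) i j = lin (fun k => gen k i j) u.
Proof. by []. Qed.

Lemma standard_zexp_inj u v : standard (expo u) -> standard (expo v) ->
  zexp u = zexp v -> u = v.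
Proof.
move=> u_std v_std /zexpP/(standard_inj u_std v_std) eq_uv.
rewrite -[u]mon_expo -[v]mon_expo; apply/mnmP => i; rewrite !mnmE.
by rewrite eq_uv // ltn_ord.
Qed.

(** The weight of x_k that the replacement of a lead lowers: counting x_15, ...,
x_20 twice takes care of the relations whose lead has more of these variables,
and x_16, x_18, x_19 get one more for r_7, r_8, r_9. *)
Definition wt (k : nat) : nat := (2 * (14 < k) + (k \in [:: 16; 18; 19]))%N.

(** The two monomials of a relation have the same image under psi, and the lead
has the larger weight. *)
Lemma rules_balanced r : r \in rules ->
  [/\ uniq r.1, all (fun k => 0 < k <= 20)%N (r.1 ++ r.2),
      (\sum_(k <- r.2) wt k < \sum_(k <- r.1) wt k)%N &
      forall i j, (1 <= j <= i)%N -> (i <= 5)%N ->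
        (\sum_(k <- r.1) gen k i j = \sum_(k <- r.2) gen k i j)%N].
Proof.
have fold_sum (F : nat -> nat) xs :
  (\sum_(k <- xs) F k = foldr (fun k m => F k + m) 0 xs)%N by rewrite unlock.
have ok : all (fun r : seq nat * seq nat =>
    [&& uniq r.1, all (fun k => 0 < k <= 20)%N (r.1 ++ r.2),
        (foldr (fun k m => wt k + m) 0 r.2 <
         foldr (fun k m => wt k + m) 0 r.1)%N &
        all (fun i => all (fun j =>
          foldr (fun k m => gen k i j + m) 0 r.1 ==
          foldr (fun k m => gen k i j + m) 0 r.2)%N (iota 1 i)) (iota 1 5)])
    rules.
  by vm_compute.
move=> /(allP ok)/and4P[r_uniq r20 r_wt /allP r_gen]; split=> //.
  by rewrite !fold_sum.
move=> i j /andP[j0 le_ji] i5; rewrite !fold_sum.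
have i0 := leq_trans j0 le_ji.
have /r_gen/allP r_gen_i : i \in iota 1 5 by rewrite mem_iota i0.
by apply/eqP/r_gen_i; rewrite mem_iota j0 add1n ltnS.
Qed.

(** * The presentation map and its kernel *)

Section Presentation.
Variable K : fieldType.

Lemma zmonomial_zexp h u :
    (forall i j, (1 <= j <= i)%N -> (i <= 5)%N ->
      h i j = (comb (expo u) i j)%:Z) ->
  zmonomial K 4 h = 'X_[zexp u].
Proof.
move=> h_u; rewrite mpolyXE_id (reindex enum_rank) /=; last first.
  exact/onW_bij/enum_rank_bij.
rewrite /zmonomial; apply: eq_bigr => p _; rewrite /zvar mnmE enum_rankK.
by rewrite h_u ?absz_nat //; [exact: (valP p) | rewrite -ltnS ltn_ord].
Qed.

(** The presentation map, which sends x_k to the monomial of the k-th generating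
hive. *)
Definition psi (p : {mpoly K[20]}) : zring K 4 :=
  p \mPo [tuple 'X_[zexp U_(i)] | i < 20].

Fact psi_zmod : zmod_morphism psi.
Proof. by move=> p q; apply: raddfB. Qed.
Fact psi_monoid : monoid_morphism psi.
Proof. by split=> [|p q]; [apply: rmorph1 | apply: rmorphM]. Qed.
Fact psi_scalable : scalable psi.
Proof. by move=> a p; apply: linearZ. Qed.
HB.instance Definition _ := GRing.isZmodMorphism.Build _ _ psi psi_zmod.
HB.instance Definition _ := GRing.isMonoidMorphism.Build _ _ psi psi_monoid.
HB.instance Definition _ := GRing.isScalable.Build K _ _ *:%R psi psi_scalable.

Lemma psiX u : psi 'X_[u] = 'X_[zexp u].
Proof.
rewrite /psi comp_mpolyX {2}[u]multinomUE_id (big_morph _ zexpD zexp0) -mprodXE.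
apply: eq_bigr => i _; rewrite tnth_mktuple mpolyXn; congr 'X_[_].
by elim: (u i) => [|m IHm]; rewrite ?mulm0n ?zexp0 // !mulmS zexpD IHm.
Qed.

Lemma psiE p : psi p = \sum_(u <- msupp p) p@_u *: 'X_[zexp u].
Proof.
rewrite {1}[p]mpolyE linear_sum; apply: eq_bigr => u _.
by rewrite linearZ /= psiX.
Qed.

Lemma psi_hive p : psi p \in @hive_pred K 4.
Proof.
rewrite psiE rpred_sum // => u _; apply: rpredZ; apply/asboolP => S _; apply.
exists (fun i j => (comb (expo u) i j)%:Z); first exact: comb_hive.
by rewrite (@zmonomial_zexp _ u).
Qed.

Lemma hive_zexp h : hive 4 h ->
  exists2 u, standard (expo u) & zmonomial K 4 h = 'X_[zexp u].
Proof.
move=> /hive_standard[s [s20 s_std h_s]]; exists (mon (seqfun s)).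
  suff: standard (expo (mon (seqfun s))) = standard (seqfun s) by move->.
  by rewrite /standard /= !expo_mon.
apply: zmonomial_zexp => i j j_i i5; rewrite h_s //; congr Posz.
by apply: eq_big_seq => k; rewrite mem_iota => k20; rewrite expo_mon.
Qed.

Lemma hive_predP v : v \in @hive_pred K 4 -> exists p, psi p = v.
Proof.
move=> /asboolP v_gen; apply/asboolP.
apply: (v_gen (fun v => `[< exists p, psi p = v >])) => [|v' [h]].
- split; first by apply/asboolP; exists 1; rewrite rmorph1.
    move=> a u w /asboolP[p <-] /asboolP[q <-]; apply/asboolP.
    by exists (a *: p + q); rewrite linearP.
  move=> u w /asboolP[p <-] /asboolP[q <-]; apply/asboolP.
  by exists (p * q); rewrite rmorphM.
- by move=> /hive_zexp[u _ ->] ->; apply/asboolP; exists 'X_[u]; rewrite psiX.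
Qed.

(** The product of the variables whose indices are listed in [xs]. *)
Definition mono (xs : seq nat) : {mpoly K[20]} :=
  \prod_(k <- xs) 'X_(inord k.-1).

Lemma monoE xs : mono xs = 'X_[mexp xs].
Proof. by rewrite /mono mprodXE. Qed.

Lemma relation_ideal r : r \in hive4_relations K -> r \in hive4_ideal K.
Proof.
move=> r_rel; apply/asboolP.
have lt_r : (index r (hive4_relations K) < size (hive4_relations K))%N.
  by rewrite index_mem.
exists (fun i => if i == Ordinal lt_r then 1 else 0).
rewrite (bigD1 (Ordinal lt_r)) //= eqxx mul1r nth_index // big1 ?addr0 //.
by move=> i /negbTE ->; rewrite mul0r.
Qed.

Lemma mono2 a b : mono [:: a; b] = 'X_(inord a.-1) * 'X_(inord b.-1).
Proof. by rewrite /mono !big_cons big_nil mulr1. Qed.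

Lemma mono3 a b c : mono [:: a; b; c] =
  'X_(inord a.-1) * 'X_(inord b.-1) * 'X_(inord c.-1).
Proof. by rewrite /mono !big_cons big_nil mulr1 mulrA. Qed.

(** The lead comes last in the first six relations and first in the others. *)
Lemma relation_rule i : (i < 15)%N ->
  let r := nth ([::], [::]) rules i in
  (hive4_relations K)`_i =
    if (i < 6)%N then mono r.2 - mono r.1 else mono r.1 - mono r.2.
Proof.
by do 15![case: i => [_|i]; first by rewrite /= !(mono2, mono3)].
Qed.

Lemma rule_ideal r : r \in rules -> mono r.1 - mono r.2 \in hive4_ideal K.
Proof.
move=> r_rule; set i := index r rules.
have lt_i : (i < 15)%N by rewrite -[15%N]/(size rules) index_mem.
have := relation_ideal (mem_nth 0 (lt_i : (i < size (hive4_relations K))%N)).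
rewrite (relation_rule lt_i) nth_index //.
by case: ifP => // _; rewrite -opprB rpredN.
Qed.

(** Every monomial is congruent to a standard one with the same image. *)
Lemma standard_reduce u : exists u',
  [/\ standard (expo u'), zexp u' = zexp u &
      'X_[u] - 'X_[u'] \in hive4_ideal K].
Proof.
have [n] := ubnP (lin wt u); elim: n u => // n IHn u; rewrite ltnS => le_u_n.
have [u_std | ] := boolP (standard (expo u)).
  by exists u; split=> //; rewrite subrr rpred0.
case/allPn=> r r_rule; rewrite -all_predC => r1_u.
have [r1_uniq r20 lt_r r_gen] := rules_balanced r_rule.
have [r1_20 r2_20] : all (fun k => 0 < k <= 20)%N r.1 /\
    all (fun k => 0 < k <= 20)%N r.2 by move: r20; rewrite all_cat => /andP.
have le_r1 := mexp_le r1_uniq r1_20 r1_u.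
have [w u_eq] : exists w, u = (w + mexp r.1)%MM.
  by exists (u - mexp r.1)%MM; rewrite submK.
have /IHn[u' [u'_std u'_z u'_id]] : (lin wt (w + mexp r.2) < n)%N.
  by apply: leq_trans le_u_n; rewrite u_eq !linD ltn_add2l !lin_mexp.
exists u'; split=> //.
  rewrite u'_z u_eq !zexpD; congr (_ + _)%MM.
  apply/zexpP => i j j_i i5; rewrite !comb_lin !lin_mexp //.
  exact/esym/r_gen.
rewrite u_eq -[X in X \in _](subrKA 'X_[w + mexp r.2]) rpredD //.
by rewrite !mpolyXD -mulrBr -!monoE idealMr // rule_ideal.
Qed.

Lemma psi_ideal p : p \in hive4_ideal K -> psi p = 0.
Proof.
move=> /asboolP[c ->]; rewrite rmorph_sum big1 // => i _; rewrite rmorphM /=.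
set r := nth ([::], [::]) rules i.
have r_rule : r \in rules by apply: mem_nth; apply: ltn_ord.
have [_ r20 _ r_gen] := rules_balanced r_rule.
have [r1_20 r2_20] : all (fun k => 0 < k <= 20)%N r.1 /\
    all (fun k => 0 < k <= 20)%N r.2 by move: r20; rewrite all_cat => /andP.
have psi_r : psi (mono r.1) = psi (mono r.2).
  rewrite !monoE !psiX; congr 'X_[_]; apply/zexpP => j k k_j j5.
  by rewrite !comb_lin !lin_mexp ?r_gen.
rewrite (relation_rule (ltn_ord i)) -/r.
by case: ifP => _; rewrite rmorphB /= psi_r subrr mulr0.
Qed.

(** The kernel of psi is contained in the ideal of the relations: reduce all
monomials to standard ones, whose images are distinct. *)
Lemma psi_ker p : psi p = 0 -> p \in hive4_ideal K.
Proof.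
have [nf nfP] := choice standard_reduce.
have p_nf : p - \sum_(u <- msupp p) p@_u *: 'X_[nf u] \in hive4_ideal K.
  rewrite {1}[p]mpolyE -sumrB rpred_sum // => u _.
  have [_ _ u_id] := nfP u.
  by rewrite -scalerBr -mul_mpolyC idealMr.
(* The coefficient of the reduced polynomial at a standard monomial [v] sums the
   coefficients of [p] at the monomials with the same image as [v], as does the
   coefficient of [psi p] at that image. *)
move=> psi_p0; suff nf0 : \sum_(u <- msupp p) p@_u *: 'X_[nf u] = 0.
  by rewrite nf0 subr0 in p_nf.
apply/mpolyP => v; rewrite mcoeff0 raddf_sum /=.
have [v_nf | v_nf] := boolP (has (fun u => nf u == v) (msupp p)); last first.
  rewrite big1_seq // => u /andP[_ u_p]; rewrite mcoeffZ mcoeffX.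
  by rewrite (negbTE (hasPn v_nf u u_p)) mulr0.
have {v_nf}[u0 _ /eqP v_eq] := hasP v_nf.
have := congr1 (mcoeff (zexp v)) psi_p0; rewrite psiE mcoeff0 raddf_sum /=.
apply: etrans; apply: eq_bigr => u _; rewrite !mcoeffZ !mcoeffX -v_eq.
have [u_std u_z _] := nfP u; have [u0_std u0_z _] := nfP u0.
rewrite -u_z; congr (_ * (nat_of_bool _)%:R).
by apply/eqP/eqP => [-> // | /(standard_zexp_inj u_std u0_std)].
Qed.

End Presentation.

Lemma inj_surj_bij (T : choiceType) (U : eqType) (f : T -> U) :
  injective f -> (forall y, exists x, f x = y) -> bijective f.
Proof.
move=> f_inj f_surj.
have /choice[g gK] : forall y, exists x, f x = y by [].
by exists g => // x; apply: f_inj; rewrite gK.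
Qed.

(** The isomorphism lifts an element of the codomain along [f] and projects the
lift to the quotient. *)
Lemma first_isomorphism (K : fieldType) (A : comAlgType K) (I : idealr A)
    (B : algType K) (f : {lrmorphism A -> B}) :
    (forall b, exists a, f a = b) -> (forall a, f a = 0 <-> a \in I) ->
  exists phi : {lrmorphism B -> quot_alg I}, bijective phi.
Proof.
move=> f_surj f_ker.
have [s sK] := choice f_surj.
pose phi b : quot_alg I := quot_pi I (s b).
have pi_eq a a' : f a = f a' -> quot_pi I a = quot_pi I a'.
  move=> eq_f; apply/eqP; rewrite -Quotient.idealrBE; apply/f_ker.
  by rewrite rmorphB /= eq_f subrr.
have phiB : zmod_morphism phi.
  by move=> b c; rewrite /phi -rmorphB; apply: pi_eq; rewrite rmorphB /= !sK.
have phiM : monoid_morphism phi.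
  split.
    by rewrite /phi -(rmorph1 (quot_pi I)); apply: pi_eq; rewrite sK rmorph1.
  by move=> b c; rewrite /phi -rmorphM; apply: pi_eq; rewrite rmorphM /= !sK.
have phiZ : scalable phi.
  by move=> k b; rewrite /phi -linearZ; apply: pi_eq; rewrite linearZ /= !sK.
pose phiB_ := GRing.isZmodMorphism.Build _ _ phi phiB.
pose phiM_ := GRing.isMonoidMorphism.Build _ _ phi phiM.
pose phiZ_ := GRing.isScalable.Build K _ _ *:%R phi phiZ.
pose phi_lr : {lrmorphism B -> quot_alg I} := HB.pack phi phiB_ phiM_ phiZ_.
exists phi_lr; apply: inj_surj_bij.
  move=> b c /eqP; rewrite -Quotient.idealrBE => /f_ker.
  by rewrite rmorphB /= !sK => /eqP; rewrite subr_eq0 => /eqP.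
move=> q; exists (f (repr q)); rewrite -[RHS]reprK.
by apply: pi_eq; rewrite sK.
Qed.

Section Isomorphism.
Variable K : fieldType.

(** The presentation map with values in the hive algebra. *)
Definition hpsi (p : {mpoly K[20]}) : hive_algebra K 4 :=
  HiveAlgebra (psi_hive p).

Fact hpsi_zmod : zmod_morphism hpsi.
Proof. by move=> p q; apply: val_inj; rewrite /= rmorphB. Qed.
Fact hpsi_monoid : monoid_morphism hpsi.
Proof. by split=> [|p q]; apply: val_inj; rewrite /= ?rmorph1 ?rmorphM. Qed.
Fact hpsi_scalable : scalable hpsi.
Proof. by move=> a p; apply: val_inj; rewrite /= linearZ. Qed.
HB.instance Definition _ := GRing.isZmodMorphism.Build _ _ hpsi hpsi_zmod.
HB.instance Definition _ := GRing.isMonoidMorphism.Build _ _ hpsi hpsi_monoid.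
HB.instance Definition _ :=
  GRing.isScalable.Build K _ _ *:%R hpsi hpsi_scalable.

Lemma hive_algebra_presentation :
  exists phi : {lrmorphism hive_algebra K 4 -> hive4_quotient K}, bijective phi.
Proof.
apply: (@first_isomorphism K _ (hive4_ideal K : idealr _) _ hpsi) => [v|p].
  have [p p_v] := hive_predP (valP v).
  by exists p; apply: val_inj.
split=> [/(congr1 val) /psi_ker // | /psi_ideal p0].
exact: val_inj.
Qed.

End Isomorphism.

(** * Enumeration of standard monomials *)

(** The degree of x_k, that is, the corner entry of the k-th generator. *)
Definition wdeg (k : nat) : nat := gen k 5 5.

(** x_k and x_l do not form a lead. *)
Definition nconf (k l : nat) : bool :=
  ~~ has (fun r : seq nat * seq nat =>
    (r.1 == [:: k; l]) || (r.1 == [:: l; k])) rules.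

(** The indices in [l] of the variables that divide the monomial [c]. *)
Definition supp (c : nat -> nat) (l : seq nat) := [seq k <- l | c k != 0%N].

(** A monomial is standard when its support is an independent set of the graph
whose edges are the leads. *)
Lemma standard_pairwise c : standard c = pairwise nconf (supp c (iota 1 20)).
Proof.
rewrite pairwise_all2rel; first last.
- by move=> k l; rewrite /nconf; congr negb; apply: eq_has => r; rewrite orbC.
- move=> k; apply/hasPn => r r_rule; rewrite orbb.
  have [+ _ _ _] := rules_balanced r_rule; apply: contraL => /eqP ->.
  by rewrite /= inE eqxx.
apply/allP/allrelP => [c_std k l | c_std r r_rule].
  rewrite !mem_filter => /andP[ck _] /andP[cl _]; apply/hasPn => r r_rule.
  have := c_std r r_rule; apply: contraL => /orP[] /eqP -> /=.
    by rewrite (negbTE ck) (negbTE cl).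
  by rewrite (negbTE ck) (negbTE cl).
have : all (fun r : seq nat * seq nat =>
    r.1 == [:: nth 0 r.1 0; nth 0 r.1 1]%N) rules.
  by vm_compute.
move=> /allP/(_ r r_rule)/eqP; have [_ r20 _ _] := rules_balanced r_rule.
move: r20; rewrite all_cat => /andP[+ _].
case E: r => [r1 r2] /= + r1E; rewrite r1E /= orbF andbT => /andP[a20 b20].
apply/negPn/negP; rewrite negb_or => /andP[ca cb].
have in_supp k : (0 < k <= 20)%N -> c k != 0%N -> k \in supp c (iota 1 20).
  by move=> k20 ck_neq0; rewrite mem_filter ck_neq0 mem_iota.
have /hasPn/(_ r r_rule) := c_std _ _ (in_supp _ a20 ca) (in_supp _ b20 cb).
by rewrite E /= {1}r1E eqxx.
Qed.

(** The exponents, on the variables listed in [l], of the monomials of degree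
[d] whose support is an independent set, none of whose elements is adjacent to
an element of [s]. *)
Fixpoint std_exps (l s : seq nat) (d : nat) : seq (seq nat) :=
  if l is k :: l' then
    [seq j :: u | j <- [seq j <- iota 0 d.+1 | (j * wdeg k <= d)%N &
                         (j == 0%N) || all (nconf^~ k) s],
                  u <- std_exps l' (if j == 0%N then s else k :: s)
                                (d - j * wdeg k)]
  else if d == 0%N then [:: [::]] else [::].

Lemma std_exps_cons k l s d : std_exps (k :: l) s d =
  [seq j :: u | j <- [seq j <- iota 0 d.+1 | (j * wdeg k <= d)%N &
                       (j == 0%N) || all (nconf^~ k) s],
                u <- std_exps l (if j == 0%N then s else k :: s)
                              (d - j * wdeg k)].
Proof. by []. Qed.

Lemma size_std_exps l s d u : u \in std_exps l s d -> size u = size l.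
Proof.
elim: l s d u => [|k l IHl] s d u.
  by rewrite /=; case: ifP => // _; rewrite inE => /eqP ->.
rewrite std_exps_cons => /flatten_mapP[j _ /mapP[u' /IHl u'_l ->]].
by rewrite /= u'_l.
Qed.

Lemma std_exps_uniq l s d : uniq (std_exps l s d).
Proof.
elim: l s d => [|k l IHl] s d; first by rewrite /=; case: ifP.
rewrite std_exps_cons.
apply: allpairs_uniq_dep => [|j _|[j u] [j' u'] _ _ /= []].
- by rewrite filter_uniq ?iota_uniq.
- exact: IHl.
- by move=> -> ->.
Qed.

Lemma mem_std_exps c l s d : all (fun k => 0 < wdeg k)%N l ->
  ([seq c k | k <- l] \in std_exps l s d) =
  [&& (\sum_(k <- l) c k * wdeg k)%N == d,
      allrel nconf s (supp c l) & pairwise nconf (supp c l)].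
Proof.
elim: l s d => [|k l IHl] s d.
  by rewrite big_nil allrel0r eq_sym /=; case: eqP.
case/andP=> k_gt0 l_gt0.
have E j u : (j :: u \in std_exps (k :: l) s d) =
    [&& (j * wdeg k <= d)%N, (j == 0%N) || all (nconf^~ k) s &
        u \in std_exps l (if j == 0%N then s else k :: s) (d - j * wdeg k)].
  rewrite std_exps_cons; apply/flatten_mapP/and3P.
    case=> j' + /mapP[u' + []].
    by rewrite mem_filter => /andP[/andP[? ?] _] ? [-> ->].
  case=> le_jd j_s u_l.
  exists j; last exact: map_f.
  rewrite mem_filter le_jd j_s mem_iota /= add0n ltnS.
  by apply: leq_trans le_jd; rewrite leq_pmulr.
rewrite map_cons E {}IHl // big_cons.
have le_sub x y : ((x <= d)%N && (y == d - x)%N) = (x + y == d)%N by lia.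
have [ck0 | ck_neq0] := eqVneq (c k) 0%N; rewrite /= ?ck0 ?ck_neq0 /=.
  by rewrite mul0n subn0 add0n.
rewrite allrel_consl allrel_consr -le_sub -!andbA.
by do !bool_congr; rewrite andbCA.
Qed.

(** The standard monomials of degree [d], without repetition. *)
Definition std_mons (d : nat) : seq 'X_{1..20} :=
  [seq mon (seqfun s) | s <- std_exps (iota 1 20) [::] d].

Lemma seqfun_expo u : seqfun [seq expo u k | k <- iota 1 20] =1
  fun k => if (k <= 20)%N then expo u k else 0%N.
Proof.
case=> [|k]; first by [].
have [k20 | k20] := ltnP k 20.
  by rewrite /seqfun (nth_map 0%N) ?size_iota // nth_iota.
by rewrite /seqfun nth_default // size_map size_iota.
Qed.

Lemma mon_seqfun u : mon (seqfun [seq expo u k | k <- iota 1 20]) = u.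
Proof.
by rewrite -[RHS]mon_expo; apply/mnmP => i; rewrite !mnmE seqfun_expo ltn_ord.
Qed.

Lemma expo_mon_seqfun s : size s = 20%N ->
  [seq expo (mon (seqfun s)) k | k <- iota 1 20] = s.
Proof.
move=> s20; apply: (@eq_from_nth _ 0%N) => [|i].
  by rewrite size_map size_iota.
rewrite size_map size_iota => i20.
by rewrite (nth_map 0%N) ?size_iota // nth_iota // expo_mon.
Qed.

Lemma std_mons_uniq d : uniq (std_mons d).
Proof.
rewrite map_inj_in_uniq; first exact: std_exps_uniq.
move=> s s' /size_std_exps s20 /size_std_exps s'20 eq_ss'.
by rewrite -[s]expo_mon_seqfun ?eq_ss' ?expo_mon_seqfun.
Qed.

Lemma mem_std_mons d u :
  (u \in std_mons d) = standard (expo u) && (lin wdeg u == d).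
Proof.
have -> : (u \in std_mons d) =
    ([seq expo u k | k <- iota 1 20] \in std_exps (iota 1 20) [::] d).
  apply/mapP/idP => [[s s_in ->]|u_in].
    by rewrite expo_mon_seqfun // (size_std_exps s_in).
  by exists [seq expo u k | k <- iota 1 20]; rewrite ?mon_seqfun.
by rewrite mem_std_exps // standard_pairwise andbC.
Qed.

Lemma zexp_corner u : zexp u (enum_rank (corner 4)) = lin wdeg u.
Proof. by rewrite mnmE enum_rankK. Qed.

Section Dimension.
Variable K : fieldType.

Lemma msupp_hive (v : hive_algebra K 4) m :
  m \in msupp (hive_val v : {mpoly K[N]}) ->
  exists2 u, standard (expo u) & m = zexp u.
Proof.
have [p <-] := hive_predP (valP v); rewrite psiE => /msupp_sum_le.
case/flatten_mapP=> u _ /msuppZ_le; rewrite msuppX inE => /eqP ->.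
by have [u' [u'_std <- _]] := standard_reduce K u; exists u'.
Qed.

(** The images of the standard monomials of degree [d] form a basis of the
component of degree [d]. *)
Lemma hive_component_dim d :
  has_dim (@hive_component K 4 d) (size (std_mons d)).
Proof.
have := mem_std_mons d; have := std_mons_uniq d.
move: (std_mons d) => L L_uniq mem_L; pose u i := nth 0%MM L i.
have uP (i : 'I_(size L)) : standard (expo (u i)) /\ lin wdeg (u i) = d.
  by have := mem_nth 0%MM (ltn_ord i); rewrite mem_L => /andP[? /eqP].
have u_inj : injective (fun i : 'I_(size L) => zexp (u i)).
  move=> i j /(standard_zexp_inj (uP i).1 (uP j).1)/eqP.
  by rewrite nth_uniq // => /eqP/val_inj.
have sumE (c : 'I_(size L) -> K) :
    hive_val (\sum_i c i *: hpsi ('X_[u i] : {mpoly K[20]})) =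
    \sum_i c i *: 'X_[zexp (u i)] :> zring K 4.
  have -> : \sum_i c i *: hpsi ('X_[u i] : {mpoly K[20]}) =
      hpsi (\sum_i c i *: 'X_[u i]).
    by rewrite linear_sum; apply: eq_bigr => i _; rewrite linearZ.
  rewrite -[LHS]/(psi (\sum_i c i *: 'X_[u i])).
  by rewrite linear_sum; apply: eq_bigr => i _; rewrite linearZ /= psiX.
exists (fun i => hpsi 'X_[u i]); split=> [i|c /(congr1 (@hive_val K 4))|v v_d].
- rewrite unfold_in /= psiX msuppX /= andbT zexp_corner.
  by have [_ ->] := uP i.
- rewrite sumE => c0 i; have := congr1 (mcoeff (zexp (u i))) c0.
  rewrite mcoeff0 raddf_sum /= (bigD1 i) //= mcoeffZ mcoeffX eqxx mulr1.
  rewrite big1 ?addr0 // => j ne_ji.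
  by rewrite mcoeffZ mcoeffX (inj_eq u_inj) (negbTE ne_ji) mulr0.
exists (fun i => (hive_val v : {mpoly K[N]})@_(zexp (u i))).
apply: val_inj; rewrite -[RHS]/(hive_val _) sumE /=; apply/mpolyP => m.
rewrite raddf_sum /=.
have [m_v | m_v] := boolP (m \in msupp (hive_val v : {mpoly K[N]})); last first.
  rewrite (memN_msupp_eq0 m_v) big1 // => i _; rewrite mcoeffZ mcoeffX.
  by case: eqP => [->|]; rewrite ?mulr0 // (memN_msupp_eq0 m_v) mul0r.
have [w w_std m_w] := msupp_hive m_v.
have w_L : w \in L.
  by rewrite mem_L w_std -zexp_corner -m_w; apply: (allP v_d).
have lt_w : (index w L < size L)%N by rewrite index_mem.
have u_w : u (Ordinal lt_w) = w by rewrite /u nth_index.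
rewrite (bigD1 (Ordinal lt_w)) //= mcoeffZ mcoeffX u_w -m_w eqxx mulr1.
rewrite big1 ?addr0 // => j ne_j; rewrite mcoeffZ mcoeffX m_w -u_w.
by rewrite (inj_eq u_inj) (negbTE ne_j) mulr0.
Qed.

End Dimension.

(** * Truncated power series *)

Section Truncation.
Implicit Types p q r : {poly int}.

(** Congruence modulo the [D]-th power of the variable. *)
Definition eqmod (D : nat) p q := forall i, (i < D)%N -> p`_i = q`_i.

Lemma eqmod_trans D q p r : eqmod D p q -> eqmod D q r -> eqmod D p r.
Proof. by move=> pq qr i iD; rewrite pq ?qr. Qed.

Lemma eqmodD D p p' q q' :
  eqmod D p p' -> eqmod D q q' -> eqmod D (p + q) (p' + q').
Proof. by move=> pp' qq' i iD; rewrite !coefD pp' ?qq'. Qed.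

Lemma eqmodMl D p q r : eqmod D q r -> eqmod D (p * q) (p * r).
Proof.
move=> qr i iD; rewrite !coefM; apply: eq_bigr => j _.
by rewrite qr // (leq_ltn_trans _ iD) ?leq_subr.
Qed.

(** A power series with constant term 1 can be cancelled. *)
Lemma eqmod_cancel D p q r : p`_0 = 1 -> eqmod D (p * q) (p * r) -> eqmod D q r.
Proof.
move=> p0 pqr i; have [n] := ubnP i; elim: n i => // n IHn i.
rewrite ltnS => le_in iD.
have := pqr i iD; rewrite !coefM !big_ord_recl !subn0 p0 !mul1r.
have -> : forall s, \sum_(j < i) p`_(lift ord0 j) * s`_(i - lift ord0 j) =
   \sum_(j < i) p`_j.+1 * s`_(i - j.+1) by [].
rewrite (eq_bigr (fun j : 'I_i => p`_j.+1 * r`_(i - j.+1))); first exact: addIr.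
move=> j _; have lt_ji : (i - j.+1 < i)%N.
  by rewrite ltn_subrL /= (leq_ltn_trans _ (ltn_ord j)).
by rewrite IHn //; [apply: leq_trans lt_ji le_in | apply: ltn_trans lt_ji iD].
Qed.

(** The power series with coefficients [f], truncated in degree [D]. *)
Definition ser (D : nat) (f : nat -> nat) : {poly int} :=
  \poly_(i < D) (f i)%:Z.

Lemma series_quotientP (f g : {poly int}) s :
  (forall D, eqmod D (g * ser D s) f) -> series_quotient f g s.
Proof.
move=> gs d; rewrite -(gs d.+1 d) // coefM; apply: eq_bigr => i _.
by rewrite coef_poly ltnS leq_subr.
Qed.

End Truncation.

(** * Polynomials as lists of coefficients *)

(** The sum of two polynomials, the product of a polynomial by the [w]-th power
of the variable, and its product by one minus that power. *)
Fixpoint addl (p q : seq int) : seq int :=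
  match p, q with
  | [::], _ => q
  | _, [::] => p
  | a :: p', b :: q' => a + b :: addl p' q'
  end.

Definition shiftl (w : nat) (p : seq int) : seq int := nseq w 0 ++ p.

Definition mul1X (w : nat) (p : seq int) : seq int :=
  addl p (shiftl w [seq - a | a <- p]).

Lemma Poly_addl p q : Poly (addl p q) = Poly p + Poly q.
Proof.
elim: p q => [|a p IHp] [|b q]; rewrite /= ?add0r ?addr0 //.
by rewrite !cons_poly_def IHp polyCD mulrDl addrACA.
Qed.

Lemma Poly_shiftl w p : Poly (shiftl w p) = 'X^w * Poly p.
Proof.
elim: w => [|w IHw]; first by rewrite mul1r.
by rewrite /shiftl /= cons_poly_def -/(shiftl w p) IHw addr0 mulrAC -exprSr.
Qed.

Lemma Poly_opp p : Poly [seq - a | a <- p] = - Poly p :> {poly int}.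
Proof.
elim: p => [|a p IHp]; first by rewrite oppr0.
by rewrite /= !cons_poly_def IHp polyCN opprD mulNr.
Qed.

Lemma Poly_mul1X w p : Poly (mul1X w p) = (1 - 'X^w) * Poly p.
Proof. by rewrite Poly_addl Poly_shiftl Poly_opp mulrN mulrBl mul1r. Qed.

Lemma Poly_prod ws p :
  Poly (foldr mul1X p ws) = (\prod_(w <- ws) (1 - 'X^w)) * Poly p.
Proof.
elim: ws => [|w ws IHws]; first by rewrite big_nil mul1r.
by rewrite [foldr _ _ _]/= Poly_mul1X IHws big_cons mulrA.
Qed.

(** * The generating series of standard monomials *)

(** The numerator of the generating series of [std_exps l s] over [den l].  When
x_k is adjacent neither to [s] nor to [l'], its exponent is free and
contributes the factor (1 - t^w) + t^w = 1 with w = deg x_k; this case only serves to keep the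
number of recursive calls small. *)
Fixpoint num (l s : seq nat) : seq int :=
  if l is k :: l' then
    if ~~ all (nconf^~ k) s then mul1X (wdeg k) (num l' s)
    else if all (nconf k) l' then num l' s
    else addl (mul1X (wdeg k) (num l' s)) (shiftl (wdeg k) (num l' (k :: s)))
  else [:: 1].

(** The product of the [1 - t^(deg x_k)] for [k] in [l]. *)
Definition den (l : seq nat) : {poly int} := \prod_(k <- l) (1 - 'X^(wdeg k)).

Definition std_count (l s : seq nat) (d : nat) : nat := size (std_exps l s d).

(** The part of [std_count (k :: l) s d] that counts positive exponents of x_k,
when x_k is not adjacent to an element of [s]. *)
Definition count_pos (k : nat) (l s : seq nat) (d : nat) : nat :=
  (\sum_(1 <= j < d.+1 | (j * wdeg k <= d)%N)
     std_count l (k :: s) (d - j * wdeg k))%N.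

Lemma count_cons k l s d : std_count (k :: l) s d =
  (std_count l s d + if all (nconf^~ k) s then count_pos k l s d else 0)%N.
Proof.
rewrite /std_count std_exps_cons size_allpairs_dep sumnE big_map big_filter.
rewrite -[iota 0 d.+1]/(0 :: iota 1 d)%N big_cons /= mul0n subn0; congr addn.
rewrite /count_pos /index_iota subn1 /=.
case: ifP => _; last first.
  rewrite big1_seq // => j; rewrite mem_iota.
  by case: j => [|j] //; rewrite /= andbF.
rewrite big_seq_cond [RHS]big_seq_cond; apply: eq_big => j; rewrite mem_iota.
  by case: j => //= j; rewrite andbT.
by case: j.
Qed.

Lemma eq_std_exps l s t d :
  {in l, forall k, all (nconf^~ k) s = all (nconf^~ k) t} ->
  std_exps l s d = std_exps l t d.
Proof.
elim: l s t d => // k l IHl s t d st; rewrite !std_exps_cons st ?mem_head //.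
congr flatten; apply: eq_map => j; congr map; apply: IHl => i i_l.
by case: ifP => _ /=; rewrite st // inE i_l orbT.
Qed.

Lemma std_count_isolated k l s d :
  all (nconf k) l -> std_count l (k :: s) d = std_count l s d.
Proof.
move=> /allP k_l; congr size; apply: eq_std_exps => i /k_l /= k_i.
by rewrite k_i.
Qed.

Lemma count_pos_shift k l s d : (0 < wdeg k)%N ->
  count_pos k l s (d + wdeg k) = (std_count l (k :: s) d + count_pos k l s d)%N.
Proof.
move=> k_gt0; rewrite {1}/count_pos big_ltn_cond ?mul1n ?leq_addl; last first.
  by rewrite ltnS ltn_addl.
rewrite addnK; congr addn.
rewrite big_add1 /= (big_cat_nat (n := d.+1)) //=; last first.
  by rewrite -addn1 leq_add2l.
rewrite [X in (_ + X)%N]big_nat_cond [X in (_ + X)%N]big1 ?addn0 => [|j].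
  by apply: eq_big => [j|j _]; rewrite mulSnr ?leq_add2r ?subnDr.
case/andP=> /andP[lt_dj _]; rewrite mulSnr leq_add2r => le_jd.
by have := leq_trans (leq_pmulr j k_gt0) le_jd; rewrite leqNgt lt_dj.
Qed.

Lemma count_pos_small k l s d : (d < wdeg k)%N -> count_pos k l s d = 0%N.
Proof.
move=> lt_dk; rewrite /count_pos big_nat_cond big1 // => j /andP[/andP[j0 _]].
by rewrite leqNgt (leq_trans lt_dk) // leq_pmull.
Qed.

Lemma ser_count_pos D k l s : (0 < wdeg k)%N ->
  eqmod D ((1 - 'X^(wdeg k)) * ser D (count_pos k l s))
          ('X^(wdeg k) * ser D (std_count l (k :: s))).
Proof.
move=> k_gt0 i iD; rewrite mulrBl mul1r coefB !coefXnM !coef_poly iD.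
case: ltnP => [lt_ik | le_ki]; first by rewrite count_pos_small ?subr0.
have iD' : (i - wdeg k < D)%N by rewrite (leq_ltn_trans _ iD) ?leq_subr.
by rewrite iD' -{1}(subnK le_ki) count_pos_shift // PoszD addrK.
Qed.

(** The series of [std_count l s] is [num l s] over [den l]. *)
Lemma den_count D l s : all (fun k => 0 < wdeg k)%N l ->
  eqmod D (den l * ser D (std_count l s)) (Poly (num l s)).
Proof.
elim: l s => [|k l IHl] s.
  move=> _ i iD; rewrite /den big_nil mul1r coef_poly iD /= cons_poly_def.
  by rewrite mul0r add0r coefC /std_count /=; case: eqP.
case/andP=> k_gt0 l_gt0; rewrite /den big_cons -/(den l).
have IH p t := eqmodMl p (IHl t l_gt0).
have [s_k | s_k] := boolP (all (nconf^~ k) s);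
  rewrite /= ?s_k ?(negbTE s_k) /=; last first.
  rewrite Poly_mul1X -mulrA.
  apply: eqmod_trans (IH _ s); apply/eqmodMl/eqmodMl => i iD.
  by rewrite !coef_poly iD count_cons (negbTE s_k) addn0.
have split_k :
  eqmod D ((1 - 'X^(wdeg k)) * den l * ser D (std_count (k :: l) s))
    ((1 - 'X^(wdeg k)) * (den l * ser D (std_count l s)) +
     'X^(wdeg k) * (den l * ser D (std_count l (k :: s)))).
  rewrite (_ : ser D (std_count (k :: l) s) =
     ser D (std_count l s) + ser D (count_pos k l s)); last first.
    apply/polyP => j; rewrite coefD !coef_poly; case: ifP => // _.
    by rewrite count_cons s_k PoszD.
  rewrite mulrDr !mulrA; apply: eqmodD => //.
  by rewrite ![_ * den l]mulrC -!mulrA; apply/eqmodMl/ser_count_pos.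
refine (eqmod_trans split_k _); case: ifP => [k_l | _]; last first.
  by rewrite Poly_addl Poly_mul1X Poly_shiftl; apply: eqmodD; apply: IH.
rewrite (_ : ser D (std_count l (k :: s)) = ser D (std_count l s)).
  by rewrite -mulrDl subrK mul1r; apply: IHl.
by apply/polyP => j; rewrite !coef_poly std_count_isolated.
Qed.

Lemma den_coef0 l : all (fun k => 0 < wdeg k)%N l -> (den l)`_0 = 1.
Proof.
rewrite /den; elim: l => [|k l IHl] /=; first by rewrite big_nil coef1.
case/andP=> k_gt0 /IHl den_l; rewrite big_cons coef0M den_l mulr1.
rewrite coefB coef1 coefXn eq_sym.
by case: (wdeg k) k_gt0 => // w _; rewrite subr0.
Qed.

(** The coefficients of [hive4_num]. *)
Definition num4_coefs : seq int := [::
  1; -2; -2; 10; -2; -24; 22; 32; -54;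
  -18; 80; -14; -72; 34; 44; -18; -25;
  -18; 44; 34; -72; -14; 80; -18; -54;
  32; 22; -24; -2; 10; -2; -2; 1].

(** The exponents of the factors [1 - 'X^w] of [hive4_den]. *)
Definition den4_exps : seq nat :=
  [:: 12; 12; 12; 12; 2; 2; 2; 2; 2; 2; 1; 1; 1; 1]%N.

Lemma hive4_denE : hive4_den = \prod_(w <- den4_exps) (1 - 'X^w).
Proof. by rewrite /hive4_den !big_cons big_nil expr1; ring. Qed.

(** The two fractions for the generating series agree, by expanding both
products. *)
Lemma hive4_cross :
  hive4_den * Poly (num (iota 1 20) [::]) = den (iota 1 20) * hive4_num.
Proof.
have -> : den (iota 1 20) = \prod_(w <- map wdeg (iota 1 20)) (1 - 'X^w).
  by rewrite big_map.
rewrite hive4_denE -[hive4_num]/(Poly num4_coefs) -!Poly_prod.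
apply/eqP; rewrite -subr_eq0 -Poly_opp -Poly_addl; apply/eqP.
set s := addl _ _.
have : all (eq_op^~ 0) s.
  by vm_compute.
move: s => s; elim: s => // a s IHs /= /andP[/eqP -> /IHs ->].
by rewrite cons_poly_def mul0r add0r.
Qed.

Lemma hive4_series :
  series_quotient hive4_num hive4_den (std_count (iota 1 20) [::]).
Proof.
apply: series_quotientP => D.
have pos : all (fun k => 0 < wdeg k)%N (iota 1 20) by [].
apply: (eqmod_cancel (den_coef0 pos)); rewrite -hive4_cross mulrCA.
exact/eqmodMl/den_count.
Qed.

Theorem theorem2p7 (R : realType) :
  (exists phi : {lrmorphism hive_algebra R[i] 4 -> hive4_quotient R[i]},
     bijective phi) /\
  (exists m : nat -> nat, [/\
     hilbert_poincare R[i] 4 m,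
     series_quotient hive4_num hive4_den m &
     [seq m d | d <- iota 0 10] =
       [:: 1; 2; 6; 14; 34; 68; 142; 268; 508; 902]%N]).
Proof.
split; first exact: hive_algebra_presentation.
exists (std_count (iota 1 20) [::]); split.
- by move=> d; have := hive_component_dim R[i] d; rewrite size_map.
- exact: hive4_series.
by vm_compute.
Qed.
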